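(* Let $a<b$ be real. Let $f:[a,b]\to\mathbb{R}$ be such that $f'$ is absolutely continuous on $[a,b]$ and $f''\in L^p([a,b])$ for some $1\le p<\infty$. (a) If $1\le p<2$, then (taking $\phi(x)=(x-c)^2-(b-a)^2/8$, see context) $$\int_a^b f(x)\,dx=\frac{b-a}{2}\left[f(a)+f(b)\right]+\frac{(b-a)^2}{16}\left[f'(a)-f'(b)\right]+E(f),$$ where the error satisfies $|E(f)|\le\|f''\|_1(b-a)^2/16$. (b) If $2\le p<\infty$, then (taking $\phi(x)=(x-c)^2-(b-a)^2/12$) $$\int_a^b f(x)\,dx=\frac{b-a}{2}\left[f(a)+f(b)\right]+\frac{(b-a)^2}{12}\left[f'(a)-f'(b)\right]+E(f),$$ where the error satisfies $|E(f)|\le\|f''\|_2(b-a)^{5/2}/(12\sqrt5)$. (c) If $1<p<\infty$ and $1/p+1/q=1$, then (taking $\phi(x)=(x-c)^2$) $$\int_a^b f(x)\,dx=\frac{b-a}{2}\left[f(a)+f(b)\right]+\frac{(b-a)^2}{8}\left[f'(a)-f'(b)\right]+E(f),$$ where the error satisfies $$|E(f)|\le\frac{\|f''\|_p(b-a)^{2+1/q}}{2^{3+1/q}(q+1/2)^{1/q}}.$$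
   Context: $c=(a+b)/2$ is the midpoint of $[a,b]$ and $\|\cdot\|_r$ is the $L^r([a,b])$ norm. Each formula is the instance, for the indicated monic quadratic $\phi$, of the identity obtained by integration by parts $$\int_a^b f(x)\,dx=\tfrac12\left[-f(a)\phi'(a)+f(b)\phi'(b)+f'(a)\phi(a)-f'(b)\phi(b)\right]+E(f),\qquad E(f)=\tfrac12\int_a^b f''(x)\phi(x)\,dx.$$ *)

(* Defs.v *)
From HB Require Import structures.
From mathcomp Require Import all_boot all_order all_algebra.
From mathcomp Require Import all_classical all_reals all_analysis.

Set Implicit Arguments.
Unset Strict Implicit.
Unset Printing Implicit Defensive.

Import Order.TTheory GRing.Theory Num.Theory.
Import numFieldNormedType.Exports.

Local Open Scope classical_set_scope.
Local Open Scope ring_scope.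

(* A function on [a, b] is represented by a total function R -> R; its values
   outside [a, b] are irrelevant to every notion below. In particular the
   derivative is taken relative to [a, b]: two-sided on ]a, b[ and one-sided at
   a and b, unlike the library's f^`(). *)
Definition derivable_within (R : realType) (A : set R) (f : R -> R) (x : R) :=
  cvg ((f y - f x) / (y - x) @[y --> within A x^']).

(* Where f is not derivable within A, this is the default value of lim. *)
Definition derive_within (R : realType) (A : set R) (f : R -> R) (x : R) : R :=
  lim ((f y - f x) / (y - x) @[y --> within A x^']).

Definition absolutely_continuous (R : realType) (a b : R) (g : R -> R) :=
  forall e : R, 0 < e -> exists2 d : R, 0 < d &
    forall (n : nat) (u v : 'I_n -> R),
      (forall i, [/\ a <= u i, u i <= v i & v i <= b]) ->
      trivIset [set: 'I_n] (fun i => `]u i, v i[%classic) ->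
      \sum_(i < n) (v i - u i) < d ->
      \sum_(i < n) `|g (v i) - g (u i)| < e.

(* Functions on [a, b] are extended by 0 to reuse the library's L^r notions on
   the whole line; membership covers both measurability and a finite norm. *)
Definition Lfun_itv (R : realType) (r a b : R) (g : R -> R) : Prop :=
  (g \_ `[a, b]) \in Lfun (@lebesgue_measure R) r%:E.

Definition Lnorm_itv (R : realType) (r a b : R) (g : R -> R) : \bar R :=
  'N[@lebesgue_measure R]_(r%:E)[EFin \o (g \_ `[a, b])].

Definition integral_itv (R : realType) (a b : R) (g : R -> R) : R :=
  \int[@lebesgue_measure R]_(x in `[a, b]) g x.

Definition quadrature_error (R : realType) (a b : R) (phi f'' : R -> R) : R :=
  2^-1 * integral_itv a b (fun x => f'' x * phi x).

(* Main.v *)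
(* An absolutely continuous function [h] is a difference of nondecreasing
   absolutely continuous functions, whose Stieltjes measures are dominated by
   Lebesgue measure. Their Radon-Nikodym densities make [h] an indefinite
   integral, and Lebesgue differentiation identifies the integrand with the
   derivative of [h] almost everywhere. Applied to [f' * phi] this gives the
   integration by parts identity for every monic quadratic [phi]; the error
   bounds are Hoelder's inequality, with the supremum, the 2-norm or the q-norm
   of [phi] computed explicitly. *)

Require Import Defs.
From HB Require Import structures.
From mathcomp Require Import all_boot all_order all_algebra.
From mathcomp Require Import all_classical all_reals all_analysis.
From mathcomp Require Import measurable_realfun.
From mathcomp Require Import ring lra.

Set Implicit Arguments.
Unset Strict Implicit.
Unset Printing Implicit Defensive.

Import Order.TTheory GRing.Theory Num.Theory.
Import numFieldNormedType.Exports.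

Local Open Scope classical_set_scope.
Local Open Scope ring_scope.

(** * Absolute continuity and total variation *)

(** The constant term of [phi] is a free parameter: it affects only the coefficient of [f' a - f' b]
    and the norm of [phi]. Subtracting [(b - a) ^+ 2 / 8] centres the range of [phi] on [[a, b]] and
    so minimises its supremum norm (a rescaled Chebyshev polynomial); [(b - a) ^+ 2 / 12] minimises
    the 2-norm (a rescaled Legendre polynomial); 0 leaves a pure power, whose q-norm is explicit for
    every [q]. The main obstacle is that absolute continuity speaks of finite families of intervals,
    whereas domination of measures speaks of arbitrary null sets. Outer regularity leads from null
    sets to open sets, and finite unions of mesh cells exhaust the latter. *)

(* An interval is encoded as the pair (right endpoint, left endpoint), the order
   in which [variation_zip] lists the intervals of a partition. *)
Definition nonoverlapping (R : realType) (a b : R) (s : seq (R * R)) :=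
  all (fun x => [&& a <= x.2, x.2 <= x.1 & x.1 <= b]) s &&
  pairwise (fun x y => (x.1 <= y.2) || (y.1 <= x.2)) s.

(** Lists replace families indexed by ordinals because subdividing one interval of a family is then
    a mere concatenation. *)
Definition ac_seq (R : realType) (a b : R) (g : R -> R) :=
  forall e : R, 0 < e -> exists2 d : R, 0 < d &
    forall s, nonoverlapping a b s -> \sum_(x <- s) (x.1 - x.2) < d ->
      \sum_(x <- s) `|g x.1 - g x.2| < e.

Lemma absolutely_continuous_seq (R : realType) (a b : R) (g : R -> R) :
  absolutely_continuous a b g -> ac_seq a b g.
Proof.
move=> acg e /acg[d d0 H]; exists d => // s /andP[/(all_nthP (0, 0)) abs prs].
rewrite !(big_nth (0, 0)) !big_mkord.
apply: (H _ (fun i => (nth (0, 0) s i).2) (fun i => (nth (0, 0) s i).1)).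
  by move=> i; have /and3P[] := abs i (ltn_ord i).
apply/trivIsetP => i j _ _ ij; rewrite -subset0 => x /=.
rewrite !in_itv/= => -[/andP[ix xi] /andP[jx xj]].
move/pairwiseP : prs => /(_ (0, 0)) prs.
have {}ij : (i < j)%N || (j < i)%N by rewrite -neq_ltn.
case/orP : ij => ij.
  have := prs i j (ltn_ord i) (ltn_ord j) ij.
  by case/orP; lra.
have := prs j i (ltn_ord j) (ltn_ord i) ij.
by case/orP; lra.
Qed.

Lemma itv_partition_nonoverlapping (R : realType) (u v : R) (p : seq R) :
  itv_partition u v p ->
  nonoverlapping u v (zip p (u :: p)) /\
  \sum_(x <- zip p (u :: p)) (x.1 - x.2) = v - u.
Proof.
elim: p u => [u [_ /eqP/= <-]|y p ih u [/= /andP[uy yp] /eqP pv]].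
  by rewrite big_nil subrr.
have yvp : itv_partition y v p by split => //; exact/eqP.
have [/andP[yvs prs] sumE] := ih y yvp.
have yv := itv_partition_le yvp.
split; last by rewrite big_cons sumE/=; ring.
apply/andP; split => /=.
  rewrite lexx (ltW uy) yv/=; apply: sub_all yvs => x /and3P[yx xx xv].
  by rewrite xx xv (le_trans (ltW uy) yx).
rewrite prs andbT; apply: sub_all yvs => x /and3P[yx xx xv].
by rewrite yx.
Qed.

(** The pieces of [p] stay inside [[u, v]], so each lies on the same side of any other interval as
    [[u, v]] itself. *)
Lemma nonoverlapping_refine (R : realType) (a b u v : R) s1 p s2 :
  nonoverlapping u v p ->
  nonoverlapping a b (s1 ++ (v, u) :: s2) ->
  nonoverlapping a b ((s1 ++ p) ++ s2).
Proof.
move=> /andP[up pp]; rewrite /nonoverlapping -catA !all_cat/= !pairwise_cat/=.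
rewrite allrel_consr !allrel_catr.
move=> /andP[/and3P[s1ab /and3P[au uv vb] s2ab]] /and3P[].
move=> /andP[s1uv s12] ps1 /andP[uvs2 ps2].
rewrite s1ab s2ab s12 ps1 pp ps2 !andbT/=; apply/and3P; split.
- by apply: sub_all up => x /and3P[? ? ?]; apply/and3P; split; lra.
- apply/allrelP => x y xs yp.
  have /and3P[? ? ?] := allP up _ yp.
  by have /orP[?|?] := allP s1uv _ xs; apply/orP; [left|right]; simpl in *; lra.
- apply/allrelP => x y xp ys.
  have /and3P[? ? ?] := allP up _ xp.
  by have /orP[?|?] := allP uvs2 _ ys; apply/orP; [left|right]; simpl in *; lra.
Qed.

(* The intervals of [s2] are subdivided one after the other: [s1] collects those
   already subdivided, and the supremum over the subdivisions of the head of
   [s2] turns its variation into its total variation. *)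
Lemma sum_total_variation_le (R : realType) (a b d e : R) (g : R -> R) :
  (forall s, nonoverlapping a b s -> \sum_(x <- s) (x.1 - x.2) < d ->
    \sum_(x <- s) `|g x.1 - g x.2| <= e) ->
  forall s2 s1, nonoverlapping a b (s1 ++ s2) ->
    \sum_(x <- s1 ++ s2) (x.1 - x.2) < d ->
    ((\sum_(x <- s1) `|g x.1 - g x.2|)%:E +
      \sum_(x <- s2) total_variation x.2 x.1 g <= e%:E)%E.
Proof.
move=> gde; elim=> [s1|[v u] s2 ih s1 abs sd].
  by rewrite cats0 => abs sd; rewrite big_nil adde0 lee_fin gde.
have step p : itv_partition u v p ->
    ((\sum_(x <- s1) `|g x.1 - g x.2|)%:E +
     ((variation u v g p)%:E + \sum_(x <- s2) total_variation x.2 x.1 g)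
      <= e%:E)%E.
  move=> uvp; have [pp sumE] := itv_partition_nonoverlapping uvp.
  have := ih (s1 ++ zip p (u :: p)) (nonoverlapping_refine pp abs).
  rewrite !big_cat/= sumE -(variation_zip _ uvp) EFinD addeA; apply.
  by move: sd; rewrite !big_cat/= big_cons/= addrA.
have s2ge0 : (0 <= \sum_(x <- s2) total_variation x.2 x.1 g)%E.
  have /andP[] := abs; rewrite all_cat/= => /and3P[_ _ /allP s2ab] _.
  rewrite big_seq; apply: sume_ge0 => x /s2ab/and3P[_ ? _].
  exact: total_variation_ge0.
have uv : u <= v.
  have /andP[] := abs; rewrite all_cat/= => /and3P[_ /and3P[]].
  by [].
rewrite big_cons/=.
(* Isolating the variation of the head before taking its supremum requires a finite tail. A single
   partition of [[u, v]], empty when [u = v], already bounds the tail through [step]. *)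
have s2fin : (\sum_(x <- s2) total_variation x.2 x.1 g)%E \is a fin_num.
  rewrite ge0_fin_numE//.
  have [p uvp] : exists p, itv_partition u v p.
    move: uv; rewrite le_eqVlt => /predU1P[->|uv].
      by exists [::]; split => /=.
    by exists [:: v]; exact: itv_partition1.
  apply: (@le_lt_trans _ _
    (e - \sum_(x <- s1) `|g x.1 - g x.2| - variation u v g p)%:E).
    by rewrite !EFinB leeBrDr// leeBrDr// addeC (addeC _ (_ g p)%:E) step.
  by rewrite ltry.
rewrite [leLHS]addeCA -leeBrDr; last first.
  by rewrite fin_numD; apply/andP.
apply: ge_ereal_sup => _ /= [_ [p uvp <-] <-].
rewrite leeBrDr; last by rewrite fin_numD; apply/andP.
by rewrite addeCA step.
Qed.

Lemma nonoverlapping1 (R : realType) (a b u v : R) :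
  a <= u -> u <= v -> v <= b -> nonoverlapping a b [:: (v, u)].
Proof. by move=> au uv vb; rewrite /nonoverlapping/= au uv vb. Qed.

(** With [d] the modulus for 1, every subinterval shorter than [d] has total variation at most 1,
    and [[a, b]] is a chain of finitely many such subintervals. *)
Lemma ac_seq_bounded_variation (R : realType) (a b : R) (g : R -> R) :
  a <= b -> ac_seq a b g -> bounded_variation a b g.
Proof.
move=> ab /(_ 1 ltr01)[d d0 gd].
have TV1 u v : a <= u -> u <= v -> v <= b -> v - u < d ->
    (total_variation u v g <= 1)%E.
  move=> au uv vb uvd.
  have gd' s : nonoverlapping a b s -> \sum_(x <- s) (x.1 - x.2) < d ->
      \sum_(x <- s) `|g x.1 - g x.2| <= 1.
    by move=> abs /(gd _ abs)/ltW.
  have := sum_total_variation_le gd' (s1 := [::]) (nonoverlapping1 au uv vb).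
  by rewrite !big_cons !big_nil/= adde0 addr0 add0e; exact.
pose N := Num.bound ((b - a) / d).
have N0 : 0 < N.+1%:R :> R by rewrite ltr0n.
pose w := (b - a) / N.+1%:R.
have w0 : 0 <= w by rewrite divr_ge0 ?subr_ge0// ltW.
have wd : w < d.
  rewrite /w ltr_pdivrMr// mulrC -ltr_pdivrMr//.
  apply: (lt_le_trans (archi_boundP _)).
    by rewrite divr_ge0 ?subr_ge0// ltW.
  by rewrite ler_nat leqW.
have wb : a + w *+ N.+1 = b.
  by rewrite -mulr_natr /w divfK ?gt_eqF// subrKC.
have TVfin k : (k <= N.+1)%N ->
    total_variation a (a + w *+ k) g \is a fin_num.
  elim: k => [_|k ih kN]; first by rewrite mulr0n addr0 total_variationxx.
  have wk : a <= a + w *+ k by rewrite lerDl mulrn_wge0.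
  have wkS : a + w *+ k <= a + w *+ k.+1 by rewrite lerD2l mulrSr lerDl.
  have wkb : a + w *+ k.+1 <= b by rewrite -wb lerD2l ler_wpMn2l.
  rewrite (total_variationD _ wk wkS) fin_numD ih ?(ltnW kN)//=.
  rewrite ge0_fin_numE ?total_variation_ge0//.
  apply: (@le_lt_trans _ _ 1%E); last by rewrite ltry.
  by apply: TV1 => //; rewrite mulrSr; lra.
by apply/bounded_variationP => //; rewrite -wb TVfin.
Qed.

Lemma fine_total_variationB (R : realType) (a b u v : R) (g : R -> R) :
  bounded_variation a b g -> a <= u -> u <= v -> v <= b ->
  total_variation u v g =
    (fine (total_variation a v g) - fine (total_variation a u g))%:E.
Proof.
move=> bvg au uv vb; have av := le_trans au uv.
have ub := le_trans uv vb.
have ufin : total_variation a u g \is a fin_num.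
  by apply/bounded_variationP => //; exact: bounded_variationl bvg.
have uvfin : total_variation u v g \is a fin_num.
  apply/bounded_variationP => //; apply: (@bounded_variationl _ _ _ b) => //.
  exact: bounded_variationr bvg.
by rewrite (total_variationD g au uv) fineD// addrC addKr fineK.
Qed.

Lemma ac_seq_total_variation (R : realType) (a b : R) (g : R -> R) :
  a <= b -> ac_seq a b g ->
  ac_seq a b (fun x => fine (total_variation a x g)).
Proof.
move=> ab acg; have bvg := ac_seq_bounded_variation ab acg.
(* A supremum preserves only a non-strict bound; halving [e] restores strictness. *)
move=> e e0; have /acg[d d0 gd] : 0 < e / 2 by rewrite divr_gt0.
exists d => // s abs sd.
have {}gd s' : nonoverlapping a b s' -> \sum_(x <- s') (x.1 - x.2) < d ->
    \sum_(x <- s') `|g x.1 - g x.2| <= e / 2.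
  by move=> abs' /(gd _ abs')/ltW.
have := sum_total_variation_le gd (s1 := [::]) abs sd.
rewrite big_nil add0e.
have /andP[/allP sab _] := abs.
rewrite big_seq (eq_bigr (fun x => `|fine (total_variation a x.1 g) -
    fine (total_variation a x.2 g)|%:E)); last first.
  move=> x /sab/and3P[ax xx xb].
  rewrite (fine_total_variationB bvg ax xx xb) ger0_norm// -lee_fin.
  by rewrite -(fine_total_variationB bvg ax xx xb) total_variation_ge0.
rewrite -big_seq sumEFin lee_fin => /le_lt_trans; apply.
by rewrite ltr_pdivrMr// ltr_pMr// ltr1n.
Qed.

Lemma ac_seqB (R : realType) (a b : R) (g h : R -> R) :
  ac_seq a b g -> ac_seq a b h -> ac_seq a b (g \- h).
Proof.
move=> acg ach e e0.
have /acg[d d0 gd] : 0 < e / 2 by rewrite divr_gt0.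
have /ach[d' d'0 hd'] : 0 < e / 2 by rewrite divr_gt0.
exists (Num.min d d'); first by rewrite lt_min d0.
move=> s abs; rewrite lt_min => /andP[sd sd'].
rewrite (splitr e); apply: le_lt_trans (ltrD (gd _ abs sd) (hd' _ abs sd')).
rewrite -big_split/=; apply: ler_sum => x _.
rewrite (_ : g x.1 - h x.1 - _ = (g x.1 - g x.2) - (h x.1 - h x.2)); last by ring.
exact: ler_normB.
Qed.

Lemma ac_seq_dist (R : realType) (a b : R) (g : R -> R) :
  ac_seq a b g -> forall e, 0 < e -> exists2 d, 0 < d &
    forall x y, a <= x <= b -> a <= y <= b -> `|x - y| < d -> `|g x - g y| < e.
Proof.
move=> acg e /acg[d d0 gd]; exists d => // x y.
wlog xy : x y / x <= y => [wl|] xab yab xyd.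
  have [xy|/ltW yx] := leP x y; first exact: wl.
  by rewrite distrC; apply: wl => //; rewrite distrC.
have /andP[ax _] := xab; have /andP[_ yb] := yab.
have := gd [:: (y, x)]; rewrite !big_cons !big_nil/= !addr0 distrC; apply.
  exact: nonoverlapping1.
by move: xyd; rewrite distrC ger0_norm// subr_ge0.
Qed.

(** * Absolutely continuous functions are indefinite integrals *)

Definition subdivision (R : realType) (a b : R) (n k : nat) : R :=
  a + (b - a) / n.+1%:R *+ k.

Lemma subdivision_last (R : realType) (a b : R) n :
  subdivision a b n n.+1 = b.
Proof.
by rewrite /subdivision -mulr_natr divfK ?subrKC// pnatr_eq0.
Qed.

Lemma subdivision_le (R : realType) (a b : R) n k l :
  a <= b -> (k <= l)%N -> subdivision a b n k <= subdivision a b n l.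
Proof.
by move=> ab kl; rewrite lerD2l ler_wpMn2l// divr_ge0// subr_ge0.
Qed.

Lemma subdivision_ge (R : realType) (a b : R) n k :
  a <= b -> a <= subdivision a b n k.
Proof. by move=> ab; rewrite lerDl mulrn_wge0// divr_ge0// subr_ge0. Qed.

Lemma subdivision_cover (R : realType) (a b x : R) n : a < x -> x <= b ->
  exists2 k, (k < n.+1)%N &
    subdivision a b n k < x <= subdivision a b n k.+1.
Proof.
move=> ax; rewrite -{1}(subdivision_last a b n).
elim: n.+1 => [|m ih xm].
  by rewrite /subdivision mulr0n addr0 leNgt ax.
have [/ih[k km kx]|mx] := leP x (subdivision a b n m).
  by exists k => //; rewrite ltnS ltnW.
by exists m => //; rewrite mx.
Qed.

Lemma subdivision_nonoverlapping (R : realType) (a b : R) n (P : pred nat) :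
  a <= b ->
  nonoverlapping a b [seq (subdivision a b n k.+1, subdivision a b n k) |
    k <- [seq k <- index_iota 0 n.+1 | P k]].
Proof.
move=> ab; apply/andP; split.
  rewrite all_map; apply/allP => k; rewrite mem_filter mem_index_iota => /andP[_ kn].
  rewrite /= subdivision_ge//= subdivision_le//=.
  by rewrite -[leRHS](subdivision_last a b n) subdivision_le.
rewrite pairwise_map; apply: (@sub_pairwise _ ltn) => [k l kl|].
  by rewrite /= subdivision_le.
by rewrite -(sorted_pairwise ltn_trans) sorted_filter//;
  [exact: ltn_trans|exact: iota_ltn_sorted].
Qed.

(** Inner approximation of [U] by whole cells of the uniform mesh. The cells are half-open so that
    they are disjoint and a Stieltjes measure gives them the exact increment of its function. *)
Definition subdivision_part (R : realType) (a b : R) (U : set R) (n : nat) : set R :=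
  \big[setU/set0]_(k < n.+1 |
      `[< `]subdivision a b n k, subdivision a b n k.+1]%classic `<=` U >])
    `]subdivision a b n k, subdivision a b n k.+1]%classic.

Lemma measurable_subdivision_part (R : realType) (a b : R) U n :
  measurable (subdivision_part a b U n).
Proof. by apply: bigsetU_measurable => k _; exact: measurable_itv. Qed.

Lemma subdivision_part_sub (R : realType) (a b : R) U n :
  subdivision_part a b U n `<=` U.
Proof.
rewrite /subdivision_part; elim/big_ind : _ => [//|A B AU BU|k /asboolP//].
by rewrite subUset.
Qed.

(** A single list [s] has to serve both measures, since absolute continuity compares lengths and
    increments over the same intervals. *)
Lemma measure_subdivision_part (R : realType) (a b : R)
    (nu : {measure set (measurableTypeR R) -> \bar R}) (F : R -> R) U n :
  a <= b ->
  (forall u v, a <= u -> u <= v -> v <= b -> nu `]u, v]%classic = (F v - F u)%:E) ->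
  exists s, [/\ nonoverlapping a b s,
     nu (subdivision_part a b U n) = (\sum_(x <- s) (F x.1 - F x.2))%:E &
     lebesgue_measure (subdivision_part a b U n) = (\sum_(x <- s) (x.1 - x.2))%:E].
Proof.
move=> ab nuE; pose P k :=
  `[< `]subdivision a b n k, subdivision a b n k.+1]%classic `<=` U >].
pose s := [seq (subdivision a b n k.+1, subdivision a b n k) |
  k <- [seq k <- index_iota 0 n.+1 | P k]].
have mE (mu : {measure set (measurableTypeR R) -> \bar R}) (G : R -> R) :
    (forall u v, a <= u -> u <= v -> v <= b -> mu `]u, v]%classic = (G v - G u)%:E) ->
    mu (subdivision_part a b U n) = (\sum_(x <- s) (G x.1 - G x.2))%:E.
  move=> muE; rewrite big_map big_filter big_mkord /subdivision_part.
  rewrite measure_bigsetU_ord//; last first.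
  - apply/trivIsetP => i j _ _ ij; rewrite -subset0 => x /=.
    rewrite !in_itv/= => -[/andP[ix xi] /andP[jx xj]].
    have {}ij : (i < j)%N || (j < i)%N by rewrite -neq_ltn.
    case/orP : ij => /(subdivision_le n ab) ij.
      by have := lt_le_trans jx xi; rewrite ltNge ij.
    by have := lt_le_trans ix xj; rewrite ltNge ij.
  rewrite -sumEFin; apply: eq_bigr => k _; apply: muE.
  - exact: subdivision_ge.
  - exact: subdivision_le.
  - by rewrite -[leRHS](subdivision_last a b n) subdivision_le.
exists s; split; [exact: subdivision_nonoverlapping|exact: mE|].
apply: (mE lebesgue_measure idfun) => u v _ uv _.
apply: (eq_trans (lebesgue_measure_itv `]u, v])) => /=.
rewrite lte_fin; case: ltP => [//|vu].
by rewrite (@le_anti _ _ u v) ?uv ?subrr.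
Qed.

(** Once the mesh is finer than the radius of a ball around [x] inside [U], the cell containing [x]
    lies in that ball. *)
Lemma subdivision_part_open (R : realType) (a b x : R) (U : set R) :
  open U -> U x -> a < x -> x <= b ->
  exists N, forall n, (N <= n)%N -> subdivision_part a b U n x.
Proof.
move=> oU Ux ax xb; have /nbhs_ballP[r/= r0 rU] := open_nbhs_nbhs (conj oU Ux).
exists (Num.bound ((b - a) / r)) => n rn.
have [k kn /andP[kx xk]] := subdivision_cover n ax xb.
have wr : (b - a) / n.+1%:R < r.
  rewrite ltr_pdivrMr ?ltr0n// mulrC -ltr_pdivrMr//.
  apply: (lt_le_trans (archi_boundP _)).
    by rewrite divr_ge0 ?subr_ge0 ?ltW// (lt_le_trans ax).
  by rewrite ler_nat leqW.
have kS : subdivision a b n k.+1 = subdivision a b n k + (b - a) / n.+1%:R.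
  by rewrite /subdivision mulrSr addrA.
rewrite /subdivision_part (bigD1 (Ordinal kn))/=.
  by left; rewrite /= in_itv/= kx.
apply/asboolP => y /=; rewrite in_itv/= => /andP[ky yk].
apply: rU; move: xk yk wr; rewrite kS /ball/= ltr_norml.
move: (_ / _) (subdivision _ _ _ _) kx ky => w t kx ky xk yk wr.
by apply/andP; split; lra.
Qed.

(* [U `&` `]a, b]] is exhausted by the sets of points that lie in the parts of
   all sufficiently fine subdivisions, and each part is a finite union of
   nonoverlapping intervals of total length less than [d]. *)
Lemma ac_seq_measure_open_le (R : realType) (a b d e : R)
    (nu : {measure set (measurableTypeR R) -> \bar R}) (F : R -> R) (U : set R) :
  a < b ->
  (forall u v, a <= u -> u <= v -> v <= b -> nu `]u, v]%classic = (F v - F u)%:E) ->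
  (forall s, nonoverlapping a b s -> \sum_(x <- s) (x.1 - x.2) < d ->
    \sum_(x <- s) `|F x.1 - F x.2| < e) ->
  open U -> (lebesgue_measure U < d%:E)%E ->
  (nu (U `&` `]a, b]) <= e%:E)%E.
Proof.
move=> ab nuE Fde oU Ud.
have mU : measurable U by exact: open_measurable.
have mP n := @measurable_subdivision_part R a b U n.
have Pe n : (nu (subdivision_part a b U n) <= e%:E)%E.
  have [s [abs -> sd]] := measure_subdivision_part U n (ltW ab) nuE.
  rewrite lee_fin; apply: (@le_trans _ _ (\sum_(x <- s) `|F x.1 - F x.2|)).
    by apply: ler_sum => x _; exact: ler_norm.
  apply/ltW/Fde => //; rewrite -lte_fin -sd; apply: le_lt_trans Ud.
  by apply: le_measure; [rewrite inE; exact: mP|rewrite inE|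
    exact: subdivision_part_sub].
(* Successive uniform meshes need not refine one another, so the parts need not increase with [n].
   Intersecting over tails gives an increasing sequence, to which continuity of [nu] from below
   applies. *)
pose W m := \bigcap_(n in [set n | (m <= n)%N]) subdivision_part a b U n.
have mW m : measurable (W m) by apply: bigcap_measurableType => n _; exact: mP.
have mWT : measurable (\bigcup_m W m) by exact: bigcupT_measurable.
have ndW : nondecreasing_seq W.
  move=> m p mp; apply/subsetPset => x Wx n /= pn.
  by apply: Wx => /=; exact: leq_trans pn.
apply: (@le_trans _ _ (nu (\bigcup_m W m))).
  apply: le_measure; rewrite ?inE//; first exact: measurableI.
  move=> x [Ux /=]; rewrite in_itv/= => /andP[ax xb].
  have [N NP] := subdivision_part_open oU Ux ax xb.
  by exists N => // n /= /NP.
have cvgW := @nondecreasing_cvg_mu _ _ _ nu W mW mWT ndW.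
rewrite -(cvg_lim _ cvgW)//; apply: lime_le; first by apply/cvg_ex; eexists; exact: cvgW.
apply: nearW => m /=; apply: le_trans (Pe m).
apply: le_measure.
- by apply/mem_set; exact: mW.
- by rewrite inE; exact: mP.
- by move=> x; apply => /=.
Qed.

(** Precomposition with this map extends a function on [[a, b]] by constants, keeping it monotone
    and continuous on the whole line, as a cumulative function must be. *)
Definition clamp (R : realType) (a b x : R) : R := Num.max a (Num.min x b).

Lemma clamp_id (R : realType) (a b x : R) : a <= x -> x <= b -> clamp a b x = x.
Proof. by move=> ax xb; rewrite /clamp min_l// max_r. Qed.

Lemma clamp_itv (R : realType) (a b x : R) : a <= b -> a <= clamp a b x <= b.
Proof. by move=> ab; rewrite /clamp le_max lexx ge_max ab ge_min lexx orbT. Qed.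

Lemma clamp_le (R : realType) (a b x y : R) : x <= y -> clamp a b x <= clamp a b y.
Proof.
by move=> xy; rewrite /clamp ge_max !le_max lexx/= le_min !ge_min xy lexx !orbT.
Qed.

Lemma clamp_dist (R : realType) (a b x y : R) : a <= b ->
  `|clamp a b x - clamp a b y| <= `|x - y|.
Proof.
move=> ab; wlog xy : x y / x <= y => [wl|].
  have [xy|/ltW yx] := leP x y; first exact: wl.
  by rewrite distrC (distrC x); exact: wl.
rewrite distrC (distrC x) !ger0_norm ?subr_ge0 ?clamp_le//.
rewrite /clamp; case: (leP x b) => ?; case: (leP y b) => ?;
  case: (leP a x) => ?; case: (leP a y) => ?; rewrite ?(max_r ab); lra.
Qed.

Lemma continuous_comp_clamp (R : realType) (a b : R) (F : R -> R) :
  a <= b -> ac_seq a b F -> continuous (F \o clamp a b).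
Proof.
move=> ab /ac_seq_dist acF x; apply/cvgrPdist_lt => e /acF[d d0 Fd].
near=> y => /=; apply: Fd; rewrite ?clamp_itv//.
apply: le_lt_trans (clamp_dist _ _ ab) _.
by near: y; apply/nbhs_ballP; exists d.
Unshelve. all: by end_near. Qed.

Lemma lebesgue_stieltjes_measure_itv (R : realType) (f : cumulative R R) (u v : R) :
  u <= v -> lebesgue_stieltjes_measure f `]u, v]%classic = (f v - f u)%:E.
Proof.
move=> uv; rewrite /lebesgue_stieltjes_measure /measure_extension.
by rewrite measurable_mu_extE/= ?wlength_itv_bnd//; exact: is_ocitv.
Qed.

Lemma ac_seq_nondecreasing_density (R : realType) (a b : R) (F : R -> R) :
  a < b -> {in `[a, b] &, {homo F : x y / x <= y}} -> ac_seq a b F ->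
  exists2 k : R -> R, (@lebesgue_measure R).-integrable setT (EFin \o k) &
    forall x, a <= x <= b ->
      F x - F a = \int[@lebesgue_measure R]_(t in `]a, x]) k t.
Proof.
move=> ab ndF acF; have ab' := ltW ab; pose G := F \o clamp a b.
have ndG : nondecreasing G.
  move=> x y xy; apply: ndF; rewrite ?in_itv/= ?clamp_itv//.
  exact: clamp_le.
have rcG : right_continuous G.
  by apply: right_continuousW; exact: continuous_comp_clamp.
pose GC : cumulative R R := HB.pack_for (cumulative R R) G
  (@isCumulative.Build R _ R G ndG rcG).
pose nu := lebesgue_stieltjes_measure GC.
have nuE u v : a <= u -> u <= v -> v <= b -> nu `]u, v]%classic = (F v - F u)%:E.
  move=> au uv vb; rewrite /nu lebesgue_stieltjes_measure_itv//=.
  by rewrite /G/= !clamp_id// ?(le_trans uv) ?(le_trans au).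
have mD : measurable (`]a, b]%classic : set (measurableTypeR R)).
  exact: measurable_itv.
have nuD : (nu `]a, b]%classic < +oo)%E by rewrite nuE// ltry.
have nudom : mfrestr mD nuD `<< (@lebesgue_measure R).
  apply/null_content_dominatesP => A mA A0.
  rewrite /= /mfrestr /mrestr; apply/eqP; rewrite eq_le measure_ge0 andbT.
  apply/lee_addgt0Pr => e /acF[d d0 Fd]; rewrite add0e.
  (* The open set enclosing [A] is chosen shorter than the modulus [d] belonging to [e]; the mass of
     [A] is then at most [e], which is arbitrary. *)
  have [U [oU AU Ud]] : exists U : set R,
      [/\ open U, A `<=` U & (lebesgue_measure U < d%:E)%E].
    have Aoo : (lebesgue_measure A < +oo)%E by rewrite A0 ltry.
    have [U [oU AU UAd]] := lebesgue_regularity_outer mA Aoo d0.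
    exists U; split => //; rewrite -(setDUK AU).
    apply: le_lt_trans (measureU2 _ _ _) _ => //.
      by apply: measurableD => //; exact: open_measurable.
    by rewrite A0 add0e.
  apply: le_trans (ac_seq_measure_open_le ab nuE Fd oU Ud).
  apply: le_measure; last exact: setSI.
    by apply/mem_set; exact: measurableI.
  by apply/mem_set; apply: measurableI => //; exact: open_measurable.
have [k [k0 kfin intk kE]] := radon_nikodym_sigma_finite nudom.
have fineE : EFin \o (fine \o k) = k.
  by apply/funext => x /=; rewrite fineK.
exists (fine \o k); first by rewrite fineE.
move=> x /andP[ax xb]; rewrite /Rintegral (eq_integral k) => [|t _]; last by rewrite /= fineK.
rewrite -kE; last exact: measurable_itv.
rewrite /= /mfrestr /mrestr setIidl -/nu; first by rewrite nuE.
by move=> y /=; rewrite !in_itv/= => /andP[-> yx]; exact: le_trans yx xb.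
Qed.

(* Total variation writes [h] as the difference of the nondecreasing functions
   [V] and [V \- h], both absolutely continuous. *)
Lemma ac_seq_density (R : realType) (a b : R) (h : R -> R) :
  a < b -> ac_seq a b h ->
  exists2 k : R -> R, (@lebesgue_measure R).-integrable setT (EFin \o k) &
    forall x, a <= x <= b ->
      h x - h a = \int[@lebesgue_measure R]_(t in `]a, x]) k t.
Proof.
move=> ab ach; have ab' := ltW ab.
have bvh := ac_seq_bounded_variation ab' ach.
pose V x := fine (total_variation a x h).
have acV : ac_seq a b V by exact: ac_seq_total_variation.
have VB x y : a <= x -> x <= y -> y <= b -> `|h y - h x| <= V y - V x.
  move=> ax xy yb; rewrite -lee_fin -(fine_total_variationB bvh ax xy yb).
  exact: total_variation_ge.
have ndV : {in `[a, b] &, {homo V : x y / x <= y}}.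
  move=> x y; rewrite !in_itv/= => /andP[ax _] /andP[_ yb] xy.
  by rewrite -subr_ge0; exact: le_trans (VB _ _ ax xy yb).
have ndVh : {in `[a, b] &, {homo V \- h : x y / x <= y}}.
  move=> x y; rewrite !in_itv/= => /andP[ax _] /andP[_ yb] xy.
  have := le_trans (ler_norm _) (VB _ _ ax xy yb); lra.
have [k intk kE] := ac_seq_nondecreasing_density ab ndV acV.
have [l intl lE] := ac_seq_nondecreasing_density ab ndVh (ac_seqB acV ach).
have intS (m : R -> R) x : (@lebesgue_measure R).-integrable setT (EFin \o m) ->
    (@lebesgue_measure R).-integrable `]a, x] (EFin \o m).
  by move=> intm; apply: integrableS intm.
exists (k \- l).
  by have := integrableB measurableT intk intl; apply: eq_integrable.
move=> x axb; rewrite RintegralB ?intS// -kE// -lE//=; ring.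
Qed.

(** * Almost everywhere differentiation *)

(** The substitution [h = y - x] links the quotient used by [derivable_within] to the one in
    increments [h] that underlies [is_derive]. *)
Lemma cvg_quotient_is_derive (R : realType) (f : R -> R) (x l : R) :
  (f y - f x) / (y - x) @[y --> x^'] --> l <-> is_derive x 1 f l.
Proof.
split=> [fl|[dfx dfl]].
  suff fl' : h^-1 *: ((f \o shift x) (h *: 1) - f x) @[h --> 0^'] --> l.
    by split; [apply/cvg_ex; exists l|exact/cvg_lim].
  apply/cvgrPdist_lt => e e0; move/cvgrPdist_lt : fl => /(_ _ e0).
  move=> /nbhs_ballP[d/= d0 H]; apply/nbhs_ballP; exists d => // h/= h0d h0.
  have := H (h + x); rewrite /ball/= opprD addrCA subrr addr0 normrN.
  move: h0d; rewrite /ball/= sub0r normrN => hd /(_ hd).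
  rewrite -subr_eq0 addrK => /(_ h0).
  by rewrite /GRing.scale/= mulr1 mulrC.
have : h^-1 *: ((f \o shift x) (h *: 1) - f x) @[h --> 0^'] --> l.
  by rewrite -dfl; exact: dfx.
move=> fl; apply/cvgrPdist_lt => e e0; move/cvgrPdist_lt : fl => /(_ _ e0).
move=> /nbhs_ballP[d/= d0 H]; apply/nbhs_ballP; exists d => // y/= xyd yx.
have := H (y - x); rewrite /ball/= sub0r normrN distrC => /(_ xyd).
by rewrite subr_eq0 => /(_ yx); rewrite /GRing.scale/= mulr1 subrK mulrC.
Qed.

Lemma within_itv_dnbhs (R : realType) (a b x : R) : a < x -> x < b ->
  within `[a, b] x^' = x^'.
Proof.
move=> ax xb; apply/seteqP; split => P /= xP; last first.
  by apply: filterS xP => y Py _.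
have xab : (x^') `[a, b]%classic.
  have : \forall y \near x, y \in `]a, b[.
    by apply: near_in_itvoo; rewrite in_itv/= ax.
  move=> /nbhs_dnbhs; apply: filterS => y/=.
  by rewrite !in_itv/= => /andP[/ltW-> /ltW->].
by apply: filterS2 xab xP => y yab; exact.
Qed.

Lemma derivable_within_is_derive (R : realType) (a b x : R) (f : R -> R) :
  a < x -> x < b -> derivable_within `[a, b] f x ->
  is_derive x 1 f (derive_within `[a, b] f x).
Proof.
move=> ax xb; rewrite /derivable_within /derive_within (within_itv_dnbhs ax xb).
by move=> fx; apply/cvg_quotient_is_derive; exact: fx.
Qed.

Lemma is_derive_within (R : realType) (a b x l : R) (f : R -> R) :
  a < x -> x < b -> is_derive x 1 f l -> derive_within `[a, b] f x = l.
Proof.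
move=> ax xb fl; rewrite /derive_within (within_itv_dnbhs ax xb).
apply/cvg_lim; first exact: Rhausdorff.
by apply/cvg_quotient_is_derive; exact: fl.
Qed.

(** Near [x] the quotient stays below [|l| + 1] in absolute value. Working within [A] covers the
    endpoints of an interval too. *)
Lemma derivable_within_continuous (R : realType) (A : set R) (x : R) (f : R -> R) :
  derivable_within A f x -> f y @[y --> within A (nbhs x)] --> f x.
Proof.
move=> /cvg_ex[/= l /cvgrPdist_lt/(_ _ ltr01)/nbhs_ballP[d/= d0 fl]].
apply/cvgrPdist_lt => e e0; apply/nbhs_ballP.
have l1 : 0 < `|l| + 1 by rewrite ltr_wpDl.
exists (Num.min d (e / (`|l| + 1))); first by rewrite /= lt_min d0 divr_gt0.
move=> y; rewrite /ball/= lt_min => /andP[yd ye] Ay.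
have [->|yx] := eqVneq y x; first by rewrite subrr normr0.
have := fl y yd yx Ay => /= lq.
have yx0 : 0 < `|y - x| by rewrite normr_gt0 subr_eq0.
have : `|(f y - f x) / (y - x)| < `|l| + 1.
  rewrite -(subrK l (_ / _)) (le_lt_trans (ler_normD _ _))//.
  by rewrite addrC ltrD2l distrC.
rewrite normf_div ltr_pdivrMr// => fyx; rewrite distrC (lt_trans fyx)//.
by rewrite mulrC -ltr_pdivlMr// distrC.
Qed.

(** [FTC1] differentiates the indefinite integral [G] almost everywhere. As [h] is only known to
    agree with [G] on [[a, b]], the derivative is transferred at interior points, near which the two
    coincide. *)
Lemma ac_seq_is_derive (R : realType) (a b : R) (h k : R -> R) :
  (@lebesgue_measure R).-integrable setT (EFin \o k) ->
  (forall x, a <= x <= b ->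
    h x - h a = \int[@lebesgue_measure R]_(t in `]a, x]) k t) ->
  {ae @lebesgue_measure R, forall x, a < x -> x < b -> is_derive x 1 h (k x)}.
Proof.
move=> intk hE.
have intS y : (@lebesgue_measure R).-integrable `]a, y] (EFin \o k).
  exact: integrableS intk.
have := FTC1 (a := BRight a) intS (open_integrable_locally openT intk).
apply: filterS; first exact: (ae_filter_ringOfSetsType lebesgue_measure).
move=> x + ax xb => /(_ ax)[dx kx].
pose G y := h a + \int[@lebesgue_measure R]_(t in `]a, y]) k t.
have : is_derive x 1 G (k x).
  rewrite -[k x]add0r; apply: is_deriveD.
  by split; [exact: dx|rewrite -derive1E; exact: kx].
apply: near_eq_is_derive.
have : \forall y \near x, y \in `]a, b[.
  by apply: near_in_itvoo; rewrite in_itv/= ax.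
apply: filterS => y; rewrite in_itv/= => /andP[ay yb].
by rewrite /G -hE ?subrKC// !ltW.
Qed.

(** * The quadrature identity *)

Lemma ac_seq_bounded (R : realType) (a b : R) (g : R -> R) :
  a <= b -> ac_seq a b g ->
  exists2 M : R, 0 < M & forall x, a <= x <= b -> `|g x| <= M.
Proof.
move=> ab acg; have bvg := ac_seq_bounded_variation ab acg.
have tv u v : a <= u -> u <= v -> v <= b ->
    `|g v - g u| <= fine (total_variation a v g) - fine (total_variation a u g).
  move=> au uv vb; rewrite -lee_fin -(fine_total_variationB bvg au uv vb).
  exact: total_variation_ge.
have V0 : 0 <= fine (total_variation a b g).
  by rewrite fine_ge0// total_variation_ge0.
(* The summand 1 makes the bound positive, so that [ac_seqM] can divide by it. *)
exists (`|g a| + fine (total_variation a b g) + 1) => [|x /andP[ax xb]].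
  by rewrite ltr_wpDl ?addr_ge0.
have gax := tv _ _ (lexx a) ax xb; have := le_trans (normr_ge0 _) (tv _ _ ax xb (lexx b)).
rewrite total_variationxx/= subr0 in gax.
have := ler_normD (g x - g a) (g a); rewrite subrK.
by move: gax; lra.
Qed.

Lemma ac_seqM (R : realType) (a b : R) (g h : R -> R) :
  a <= b -> ac_seq a b g -> ac_seq a b h -> ac_seq a b (g \* h).
Proof.
move=> ab acg ach e e0.
have [M M0 gM] := ac_seq_bounded ab acg.
have [N N0 hN] := ac_seq_bounded ab ach.
have /acg[d d0 gd] : 0 < e / 2 / N by rewrite !divr_gt0.
have /ach[d' d'0 hd'] : 0 < e / 2 / M by rewrite !divr_gt0.
exists (Num.min d d'); first by rewrite lt_min d0.
move=> s abs; rewrite lt_min => /andP[sd sd'].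
have {}gd := gd _ abs sd; have {}hd' := hd' _ abs sd'.
rewrite ltr_pdivlMr// in gd; rewrite ltr_pdivlMr// in hd'.
rewrite (splitr e); apply: le_lt_trans (ltrD gd hd').
rewrite !mulr_suml -big_split/= !big_seq; apply: ler_sum => x xs.
have /andP[/allP/(_ _ xs)/and3P[ax xx xb] _] := abs.
rewrite (_ : g x.1 * h x.1 - _ =
  (g x.1 - g x.2) * h x.1 + (h x.1 - h x.2) * g x.2); last by ring.
apply: (le_trans (ler_normD _ _)); rewrite !normrM.
by rewrite lerD// ler_wpM2l// ?hN ?gM//; apply/andP; split => //;
  [exact: le_trans xx|exact: le_trans xb].
Qed.

Lemma lipschitz_ac_seq (R : realType) (a b L : R) (g : R -> R) : 0 < L ->
  (forall x y, a <= x -> x <= y -> y <= b -> `|g y - g x| <= L * (y - x)) ->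
  ac_seq a b g.
Proof.
move=> L0 gL e e0; exists (e / L); first by rewrite divr_gt0.
move=> s abs; rewrite ltr_pdivlMr// mulrC; apply: le_lt_trans.
rewrite mulr_sumr !big_seq; apply: ler_sum => x xs.
have /andP[/allP/(_ _ xs)/and3P[ax xx xb] _] := abs.
exact: gL.
Qed.

Lemma ac_seq_within_continuous (R : realType) (a b : R) (g : R -> R) :
  a <= b -> ac_seq a b g -> {within `[a, b], continuous g}.
Proof.
move=> ab /ac_seq_dist acg; apply/subspace_continuousP => x /=.
rewrite in_itv/= => xab; apply/cvgrPdist_lt => e /acg[d d0 gd].
apply/nbhs_ballP; exists d => // y xy /=; rewrite in_itv/= => yab.
exact: gd.
Qed.

Lemma is_derive_sqrB (R : realType) (c m x : R) :
  is_derive x 1 (fun y => (y - c) ^+ 2 - m) (2 * (x - c)).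
Proof.
apply: is_derive_eq; rewrite /GRing.scale/=; ring.
Qed.

(** The difference factors through [y - x], with cofactor [(y - c) + (x - c)]; the summand 1 keeps
    the constant positive, as [lipschitz_ac_seq] requires. *)
Lemma sqrB_lipschitz (R : realType) (a b c m : R) : a < b ->
  forall x y, a <= x -> x <= y -> y <= b ->
    `|((y - c) ^+ 2 - m) - ((x - c) ^+ 2 - m)| <=
    (2 * (`|a - c| + `|b - c|) + 1) * (y - x).
Proof.
move=> ab x y ax xy yb.
rewrite (_ : _ - _ = (y - c + (x - c)) * (y - x)); last by ring.
rewrite normrM (ger0_norm (x := y - x)) ?subr_ge0// ler_wpM2r ?subr_ge0//.
have := ler_norm (a - c); have := ler_norm (b - c).
have := ler_norm (c - a); have := ler_norm (c - b).
rewrite !(distrC c) => *; rewrite ler_norml; apply/andP; split; lra.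
Qed.

Lemma continuous_sqrB (R : realType) (c m : R) :
  continuous (fun x : R => (x - c) ^+ 2 - m).
Proof.
move=> x; apply: cvgB; last exact: cvg_cst.
by apply: cvgM; apply: cvgB; [exact: cvg_id|exact: cvg_cst|
  exact: cvg_id|exact: cvg_cst].
Qed.

Lemma measurable_sqrB (R : realType) (a b c m : R) :
  measurable_fun `[a, b] (fun x : R => (x - c) ^+ 2 - m).
Proof.
apply: measurable_funTS; apply: continuous_measurable_fun.
exact: continuous_sqrB.
Qed.

Lemma ae_neq (R : realType) (r : R) : {ae @lebesgue_measure R, forall x, x != r}.
Proof.
exists [set r]; split => //; first by rewrite lebesgue_measure_set1.
by move=> x /= /negP/negPn/eqP.
Qed.

(* The density of [f' \* phi] provided by [ac_seq_density] equals
   [f'' * phi + f' * phi'] almost everywhere; the remaining integral of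
   [f' * phi'] is a classical integration by parts since [f'] is continuous. *)
Lemma corrected_trapezoid (R : realType) (a b m : R) (f : R -> R) :
  let c := (a + b) / 2 in
  let f' := derive_within `[a, b] f in
  let f'' := derive_within `[a, b] f' in
  a < b ->
  (forall x, a <= x <= b -> derivable_within `[a, b] f x) ->
  absolutely_continuous a b f' ->
  measurable_fun `[a, b] f'' ->
  integral_itv a b f =
    (b - a) / 2 * (f a + f b) +
    ((b - a) ^+ 2 / 4 - m) / 2 * (f' a - f' b) +
    quadrature_error a b (fun x => (x - c) ^+ 2 - m) f''.
Proof.
move=> c f' f'' ab df acf' mf''.
pose phi (x : R) : R := (x - c) ^+ 2 - m.
have acg := absolutely_continuous_seq acf'.
have acgphi : ac_seq a b (f' \* phi).
  apply: ac_seqM => //; first exact: ltW.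
  apply: (@lipschitz_ac_seq _ _ _ (2 * (`|a - c| + `|b - c|) + 1)).
    by rewrite ltr_wpDl// mulr_ge0// addr_ge0.
  exact: sqrB_lipschitz.
have [k intk kE] := ac_seq_density ab acg.
have [K intK KE] := ac_seq_density ab acgphi.
have cf' : {within `[a, b], continuous f'}.
  by apply: ac_seq_within_continuous => //; exact: ltW.
have cf : {within `[a, b], continuous f}.
  apply/subspace_continuousP => x; rewrite /= in_itv/= => xab.
  exact: derivable_within_continuous (df x xab).
have [_ fa fb] := (continuous_within_itvP f ab).1 cf.
(* This is the derivative of [phi], and its own derivative is 2; hence the factor [cst 2] below,
   which doubles the integral of [f]. *)
pose psi (x : R) : R := 2 * (x - c).
have cpsi : continuous psi.
  move=> x; apply: cvgM; first exact: cvg_cst.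
  by apply: cvgB; [exact: cvg_id|exact: cvg_cst].
have dpsi (x : R) : is_derive x 1 psi 2.
  by apply: is_derive_eq; rewrite /GRing.scale/=; ring.
have int_f'psi : (@lebesgue_measure R).-integrable `[a, b]
    (EFin \o (fun x => f' x * psi x)).
  apply: continuous_compact_integrable; first exact: segment_compact.
  move=> x; apply: continuousM; first exact: cf'.
  by apply: continuous_subspaceT.
have byparts : \int[@lebesgue_measure R]_(x in `[a, b]) (f x * cst 2 x) =
    f b * psi b - f a * psi a -
    \int[@lebesgue_measure R]_(x in `[a, b]) (f' x * psi x).
  apply: Rintegration_by_parts => //.
  - split => // x; rewrite in_itv/= => /andP[ax xb].
    have xab : a <= x <= b by rewrite !ltW.
    by have [] := derivable_within_is_derive ax xb (df x xab).
  - move=> x; rewrite in_itv/= => /andP[ax xb].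
    have xab : a <= x <= b by rewrite !ltW.
    by rewrite derive1E; have [] := derivable_within_is_derive ax xb (df x xab).
  - by apply: continuous_subspaceT => x; exact: cvg_cst.
  - split.
    + by move=> x _; have [] := dpsi x.
    + by apply: cvg_at_right_filter; exact: cpsi.
    + by apply: cvg_at_left_filter; exact: cpsi.
  - by move=> x _; rewrite derive1E; have [] := dpsi x.
have KI : \int[@lebesgue_measure R]_(x in `[a, b]) (f'' x * phi x) =
    (f' b * phi b - f' a * phi a) -
    \int[@lebesgue_measure R]_(x in `[a, b]) (f' x * psi x).
  have -> : f' b * phi b - f' a * phi a =
      \int[@lebesgue_measure R]_(x in `[a, b]) K x.
    have := KE b; rewrite /= => ->; last by rewrite lexx ltW.
    apply: Rintegral_itv_obnd_cbnd.
    exact: integrableS intK.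
  have intKab : (@lebesgue_measure R).-integrable `[a, b] (EFin \o K).
    exact: integrableS intK.
  rewrite -RintegralB//.
  rewrite /Rintegral; congr fine; apply: ae_eq_integral => //.
  - apply/measurable_EFinP; apply: measurable_funM => //.
    exact: measurable_sqrB.
  - apply/measurable_EFinP; apply: measurable_funB.
      by apply/measurable_EFinP; exact: (measurable_int _ intKab).
    by apply/measurable_EFinP; exact: (measurable_int _ int_f'psi).
  - have dk := ac_seq_is_derive intk kE; have dK := ac_seq_is_derive intK KE.
    have aeF : Filter (nbhs (almost_everywhere (@lebesgue_measure R))).
      exact: ae_filter_ringOfSetsType.
    have := @filterI _ _ aeF _ _ (@filterI _ _ aeF _ _ dk dK)
      (@filterI _ _ aeF _ _ (ae_neq a) (ae_neq b)).
    apply: filterS.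
    move=> x [[kx Kx] [/eqP xa /eqP xb]] /=.
    rewrite in_itv/= => /andP[ax bx]; congr EFin.
    have {}ax : a < x by rewrite lt_neqAle ax andbT; apply/eqP => /esym.
    have {}bx : x < b by rewrite lt_neqAle bx andbT; apply/eqP.
    have f'x := kx ax bx.
    (* The default value that [f''] takes where [f'] is not derivable can occur only on the null set
       already discarded. *)
    rewrite (_ : f'' x = k x); last exact: is_derive_within f'x.
    have [_ dM] := is_deriveM f'x (is_derive_sqrB c m x).
    have [_ <-] := Kx ax bx; rewrite [X in _ = X - _]dM.
    by rewrite /GRing.scale/= /psi /phi; ring.
(* Since [c] is the midpoint, [phi] has equal values and [psi] opposite values at the two ends; this
   produces [f' a - f' b] and [f a + f b]. *)
have phib : phi b = (b - a) ^+ 2 / 4 - m by rewrite /phi /c; field.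
have phia : phi a = (b - a) ^+ 2 / 4 - m by rewrite /phi /c; field.
have psib : psi b = b - a by rewrite /psi /c; field.
have psia : psi a = a - b by rewrite /psi /c; field.
have f2 : integral_itv a b f * 2 =
    \int[@lebesgue_measure R]_(x in `[a, b]) (f x * cst 2 x).
  rewrite /integral_itv -RintegralZr//.
  by apply: continuous_compact_integrable => //; exact: segment_compact.
apply: (@mulIf _ 2); first by rewrite pnatr_eq0.
rewrite f2 byparts /quadrature_error /integral_itv -/phi KI phib phia psib psia.
by field.
Qed.

(** * Error bounds *)

Lemma continuous_powR_gt0 (R : realType) (s x : R) :
  0 < x -> {for x, continuous (fun y => y `^ s)}.
Proof.
move=> x0; apply/differentiable_continuous/derivable1_diffP.
by have [] := is_derive1_powR s x0.
Qed.

Lemma continuous_powR_shift (R : realType) (s u x : R) :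
  u < x -> {for x, continuous (fun y => (y - u) `^ s)}.
Proof.
move=> ux; apply: (@continuous_comp _ _ _ (fun y => y - u) (fun y => y `^ s)).
  by apply: cvgB; [exact: cvg_id|exact: cvg_cst].
by apply: continuous_powR_gt0; rewrite subr_gt0.
Qed.

(** Differentiability of the power settles every point except [u], where it can fail for small [s];
    there [0 < s] makes the power tend to its value 0. *)
Lemma within_continuous_powR_shift (R : realType) (s u v : R) :
  0 < s -> u < v -> {within `[u, v], continuous (fun y => (y - u) `^ s)}.
Proof.
move=> s0 uv; apply/continuous_within_itvP => //; split.
- by move=> x; rewrite in_itv/= => /andP[ux _]; exact: continuous_powR_shift.
- rewrite subrr powR0 ?gt_eqF//; apply/cvgrPdist_lt => e e0.
  have /cvgrPdist_lt/(_ _ e0)/nbhs_ballP[d/= d0 H] := powR_cvg0 s0.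
  apply/nbhs_ballP; exists d => // y uyd uy; apply: H; last by rewrite /= subr_gt0.
  by move: uyd; rewrite /ball/= sub0r opprB.
- by apply: cvg_at_left_filter; exact: continuous_powR_shift.
Qed.

Lemma integral_powR_shift (R : realType) (s u v : R) : 0 < s -> u < v ->
  (\int[@lebesgue_measure R]_(x in `[u, v]) ((x - u) `^ s)%:E =
   ((v - u) `^ (s + 1) / (s + 1))%:E)%E.
Proof.
move=> s0 uv; have s10 : 0 < s + 1 by rewrite addr_gt0.
pose F x := (s + 1)^-1 * (x - u) `^ (s + 1).
have cF : {within `[u, v], continuous F}.
  have /subspace_continuousP cp := within_continuous_powR_shift s10 uv.
  apply/subspace_continuousP => x xuv.
  by apply: cvgM; [exact: cvg_cst|exact: cp].
have dF x : u < x -> is_derive x 1 F ((x - u) `^ s).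
  move=> ux; have xu0 : 0 < x - u by rewrite subr_gt0.
  have dp := is_derive1_powR (s + 1) xu0.
  have dB : is_derive x 1 (fun y => y - u) 1.
    by apply: is_derive_eq; rewrite subr0.
  have dc := @is_derive1_comp R (fun y => y `^ (s + 1)) (fun y => y - u) x _ _ dp dB.
  have := is_deriveZ (s + 1)^-1 dc.
  rewrite addrK /GRing.scale/= mulr1 mulKf//; exact: lt0r_neq0.
have [_ Fu Fv] := (continuous_within_itvP F uv).1 cF.
rewrite (@continuous_FTC2 _ _ F)//.
- by rewrite /F subrr powR0 ?gt_eqF// mulr0 sube0 mulrC.
- exact: within_continuous_powR_shift.
- split => // x; rewrite in_itv/= => /andP[ux _].
  by have [] := dF x ux.
- move=> x; rewrite in_itv/= => /andP[ux _].
  by rewrite derive1E; have [] := dF x ux.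
Qed.

Lemma integral_powR_shiftN (R : realType) (s u v : R) : 0 < s -> u < v ->
  (\int[@lebesgue_measure R]_(x in `[u, v]) ((v - x) `^ s)%:E =
   ((v - u) `^ (s + 1) / (s + 1))%:E)%E.
Proof.
move=> s0 uv; have vu : - v < - u by rewrite ltrN2.
have := integration_by_substitution_oppr (ltW uv)
  (within_continuous_powR_shift s0 vu).
rewrite integral_powR_shift// opprK (addrC (- u)) => ->.
by apply: eq_integral => x _; rewrite /= addrC.
Qed.

(** Cutting at [c] removes the absolute value, and the two halves contribute equally. *)
Lemma integral_powR_dist_mid (R : realType) (s a b : R) : 0 < s -> a < b ->
  let c := (a + b) / 2 in
  (\int[@lebesgue_measure R]_(x in `[a, b]) (`|x - c| `^ s)%:E =
   (2 * (((b - a) / 2) `^ (s + 1) / (s + 1)))%:E)%E.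
Proof.
move=> s0 ab c; have ac : a < c by rewrite /c; lra.
have cb : c < b by rewrite /c; lra.
have mf D : measurable_fun D (fun x : R => (`|x - c| `^ s)%:E).
  apply: measurable_funTS; apply/measurable_EFinP.
  apply: (measurableT_comp (measurable_powR s)).
  apply: measurableT_comp => //.
  exact: measurable_funB.
have abE : `[a, b]%classic = `[a, c[%classic `|` `[c, b]%classic.
  by rewrite -itv_bndbnd_setU// bnd_simp ltW.
rewrite abE ge0_integral_setU//=; last first.
  apply/disj_setPLR => x /=; rewrite !in_itv/= => /andP[_ xc] /andP[cx _].
  by move: xc; rewrite ltNge cx.
  exact: mf.
rewrite mulr_natl mulr2n EFinD; congr (_ + _)%E.
  apply: (eq_trans (integral_itv_bndo_bndc (mf _))).
  rewrite (_ : (b - a) / 2 = c - a); last by rewrite /c; field.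
  rewrite -integral_powR_shiftN//; apply: eq_integral => x.
  rewrite inE/= in_itv/= => /andP[_ xc].
  by rewrite distrC ger0_norm// subr_ge0.
rewrite (_ : (b - a) / 2 = b - c); last by rewrite /c; field.
rewrite -integral_powR_shift//; apply: eq_integral => x.
rewrite inE/= in_itv/= => /andP[cx _].
by rewrite ger0_norm// subr_ge0.
Qed.

Lemma measurable_restrict_itv (R : realType) (a b : R) (g : R -> R) :
  measurable_fun `[a, b] g -> measurable_fun setT (g \_ `[a, b]).
Proof. exact: (measurable_restrictT g (measurable_itv _)).1. Qed.

Lemma quadrature_error_le (R : realType) (a b : R) (phi g : R -> R) :
  measurable_fun `[a, b] g -> measurable_fun `[a, b] phi ->
  (`|quadrature_error a b phi g|%:E <=
   2^-1%:E * Lnorm_itv 1 a b (g \* phi)%R)%E.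
Proof.
move=> mg mphi; have mgp : measurable_fun `[a, b] (g \* phi).
  exact: measurable_funM.
rewrite /quadrature_error normrM EFinM ger0_norm//.
apply: lee_wpmul2l; first by rewrite lee_fin invr_ge0.
rewrite /Lnorm_itv Lnorm1 /integral_itv /Rintegral.
(* The real integral is [fine] of an extended one; an infinite value would become 0, which only
   lowers the left-hand side. *)
have fineE (x : \bar R) : (`|fine x|%:E <= `|x|)%E.
  by case: x => [r| |]//=; rewrite normr0 leey.
apply: (le_trans (fineE _)).
apply: (le_trans (le_abse_integral _ _ _)) => //.
  exact/measurable_EFinP.
rewrite integral_mkcond le_eqVlt; apply/orP; left; apply/eqP.
apply: eq_integral => x _; rewrite /= !patchE.
by case: ifPn => //= _; rewrite ?normr0.
Qed.

(** The case of exponents 1 and infinity in Hoelder's inequality, with an explicit bound [M] in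
    place of the essential supremum. *)
Lemma quadrature_error_le_sup (R : realType) (a b M : R) (phi g : R -> R) :
  measurable_fun `[a, b] g -> measurable_fun `[a, b] phi ->
  0 <= M -> (forall x, a <= x <= b -> `|phi x| <= M) ->
  (`|quadrature_error a b phi g|%:E <= Lnorm_itv 1 a b g * (M / 2)%:E)%E.
Proof.
move=> mg mphi M0 phiM; apply: (le_trans (quadrature_error_le mg mphi)).
rewrite mulrC EFinM muleCA; apply: lee_wpmul2l; first by rewrite lee_fin invr_ge0.
rewrite /Lnorm_itv !Lnorm1 -ge0_integralZr//; last first.
  apply: measurableT_comp => //; apply/measurable_EFinP.
  exact: measurable_restrict_itv.
apply: ge0_le_integral => //.
- apply: measurableT_comp => //; apply/measurable_EFinP.
  by apply: measurable_restrict_itv; exact: measurable_funM.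
- apply: emeasurable_funM => //; apply: measurableT_comp => //.
  by apply/measurable_EFinP; exact: measurable_restrict_itv.
move=> x _; rewrite /= !patchE; case: ifPn => [|_].
  rewrite inE/= in_itv/= => xab.
  by rewrite -EFinM lee_fin normrM ler_wpM2l// phiM.
by rewrite normr0 mul0e.
Qed.

Lemma quadrature_error_le_hoelder (R : realType) (a b p q : R) (phi g : R -> R) :
  measurable_fun `[a, b] g -> measurable_fun `[a, b] phi ->
  0 < p -> 0 < q -> p^-1 + q^-1 = 1 ->
  (`|quadrature_error a b phi g|%:E <=
   Lnorm_itv p a b g * (2^-1%:E * Lnorm_itv q a b phi))%E.
Proof.
move=> mg mphi p0 q0 pq; apply: (le_trans (quadrature_error_le mg mphi)).
rewrite muleCA; apply: lee_wpmul2l; first by rewrite lee_fin invr_ge0.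
have mg' : measurable_fun setT (g \_ `[a, b]) by exact: measurable_restrict_itv.
have mphi' : measurable_fun setT (phi \_ `[a, b]) by exact: measurable_restrict_itv.
rewrite /Lnorm_itv; apply: le_trans (hoelder lebesgue_measure mg' mphi' p0 q0 pq).
rewrite le_eqVlt; apply/orP; left; apply/eqP; apply: eq_Lnorm => x.
rewrite /= !patchE; case: ifPn => // _.
by rewrite mul0r.
Qed.

Lemma Lnorm_itvE (R : realType) (a b q : R) (phi : R -> R) :
  0 < q ->
  Lnorm_itv q a b phi =
  ((\int[@lebesgue_measure R]_(x in `[a, b]) (`|phi x| `^ q)%:E) `^ q^-1)%E.
Proof.
move=> q0; rewrite /Lnorm_itv unlock; congr (_ `^ _)%E.
rewrite [RHS]integral_mkcond; apply: eq_integral => x _.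
rewrite /= !patchE; case: ifPn => // _.
by rewrite normr0 powR0// gt_eqF.
Qed.

Lemma integral_itv_is_derive (R : realType) (F f : R -> R) (a b : R) :
  a < b -> (forall x : R, is_derive x 1 F (f x)) -> continuous f ->
  (\int[@lebesgue_measure R]_(x in `[a, b]) (f x)%:E = (F b - F a)%:E)%E.
Proof.
move=> ab dF cf; have cF : continuous F.
  move=> x; apply/differentiable_continuous/derivable1_diffP.
  by have [] := dF x.
rewrite (@continuous_FTC2 _ f F)//.
- exact: continuous_subspaceT.
- split.
  + by move=> x _; have [] := dF x.
  + by apply: cvg_at_right_filter; exact: cF.
  + by apply: cvg_at_left_filter; exact: cF.
- by move=> x _; rewrite derive1E; have [] := dF x.
Qed.

Lemma Lnorm2_sqrB (R : realType) (a b : R) : a < b ->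
  let c := (a + b) / 2 in
  (2^-1%:E * Lnorm_itv 2 a b (fun x => (x - c) ^+ 2 - (b - a) ^+ 2 / 12)%R =
   ((b - a) `^ (5 / 2) / (12 * Num.sqrt 5))%:E)%E.
Proof.
move=> ab c; rewrite Lnorm_itvE//=; set m := (b - a) ^+ 2 / 12.
pose F (x : R) : R := (x - c) ^+ 5 / 5 - 2 * m * (x - c) ^+ 3 / 3 + m ^+ 2 * (x - c).
have dF (x : R) : is_derive x 1 F (((x - c) ^+ 2 - m) ^+ 2).
  by apply: is_derive_eq; rewrite /GRing.scale/=; field.
have cphi := @continuous_sqrB R c m.
have -> : (\int[@lebesgue_measure R]_(x in `[a, b])
    (`|(x - c) ^+ 2 - m| `^ 2)%:E)%E = ((b - a) ^+ 5 / 180)%:E.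
  transitivity (\int[@lebesgue_measure R]_(x in `[a, b])
      (((x - c) ^+ 2 - m) ^+ 2)%:E)%E.
    by apply: eq_integral => x _; rewrite powR_mulrn// real_normK// num_real.
  rewrite (integral_itv_is_derive ab dF).
    by congr EFin; rewrite /F /m /c; field.
  by move=> x; apply: cvgM; exact: cphi.
have ba0 : 0 <= b - a by rewrite subr_ge0 ltW.
rewrite poweR_EFin -EFinM; congr EFin.
rewrite powRrM -[5 : R]/(5%:R) powR_mulrn// !powR12_sqrt ?divr_ge0 ?exprn_ge0//.
(* The square factor leaves the root as 6, and the leading one half turns it into the 12 of the
   bound. *)
rewrite (_ : (b - a) ^+ 5 / 180 = (b - a) ^+ 5 * (6 ^+ 2 * 5)^-1); last by field.
rewrite sqrtrM ?exprn_ge0// sqrtrV ?mulr_ge0//.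
have -> : Num.sqrt (6 ^+ 2 * 5) = 6 * Num.sqrt 5 :> R.
  by rewrite sqrtrM ?exprn_ge0// sqrtr_sqr ger0_norm.
by field; rewrite sqrtr_eq0 -ltNge ltr0n.
Qed.

Lemma Lnorm_sqrB (R : realType) (a b q : R) : a < b -> 0 < q ->
  let c := (a + b) / 2 in
  (2^-1%:E * Lnorm_itv q a b (fun x => (x - c) ^+ 2)%R =
   ((b - a) `^ (2 + q^-1) / (2 `^ (3 + q^-1) * (q + 2^-1) `^ q^-1))%:E)%E.
Proof.
move=> ab q0 c; rewrite Lnorm_itvE//.
have -> : (\int[@lebesgue_measure R]_(x in `[a, b]) (`|(x - c) ^+ 2| `^ q)%:E =
    \int[@lebesgue_measure R]_(x in `[a, b]) (`|x - c| `^ (2 * q))%:E)%E.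
  by apply: eq_integral => x _; rewrite normrX powRrM powR_mulrn.
rewrite integral_powR_dist_mid ?mulr_gt0// poweR_EFin -EFinM; congr EFin.
have ba0 : 0 < b - a by rewrite subr_gt0.
have h0 : 0 <= (b - a) / 2 by rewrite divr_ge0 ?ltW.
have q20 : 0 < q + 2^-1 by rewrite addr_gt0.
have q210 : 0 < 2 * q + 1 by rewrite addr_gt0 ?mulr_gt0.
(* As [2 * q + 1] is twice [q + 2^-1], the factor 2 from the two halves cancels. *)
have -> : 2 * (((b - a) / 2) `^ (2 * q + 1) / (2 * q + 1)) =
    ((b - a) / 2) `^ (2 * q + 1) * (q + 2^-1) `^ (-1).
  by rewrite powR_inv1 ?ltW//; field; rewrite mulrC gt_eqF.
rewrite powRM ?powR_ge0// -!powRrM mulN1r powRN.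
rewrite (_ : (2 * q + 1) / q = 2 + q^-1); last by field; rewrite gt_eqF.
rewrite powRM ?invr_ge0// ?ltW// -(powR_inv1 (a := 2))// -powRrM mulN1r powRN.
(* The power [2 + q^-1] of 2 comes from the half-length [(b - a) / 2], the remaining factor from the
   one half in front of the norm. *)
rewrite (_ : 3 + q^-1 = 1 + (2 + q^-1)); last by ring.
rewrite (powRD (x := 2)) ?pnatr_eq0 ?implybT// powRr1//.
rewrite !powRN.
have /lt0r_neq0 q1 := powR_gt0 q^-1 q20.
have /lt0r_neq0 q2 := powR_gt0 (2 + q^-1) (ltr0Sn R 1).
by field; rewrite q1.
Qed.

Theorem theorem3p2 (R : realType) (a b : R) (f : R -> R) (p : R) :
  let c := (a + b) / 2 in
  let f' := derive_within `[a, b] f in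
  let f'' := derive_within `[a, b] f' in
  let E := fun phi : R -> R => quadrature_error a b phi f'' in
  a < b ->
  (forall x, a <= x <= b -> derivable_within `[a, b] f x) ->
  absolutely_continuous a b f' ->
  1 <= p ->
  Lfun_itv p a b f'' ->
  [/\ p < 2 ->
        let phi := fun x => (x - c) ^+ 2 - (b - a) ^+ 2 / 8 in
        integral_itv a b f =
          (b - a) / 2 * (f a + f b) + (b - a) ^+ 2 / 16 * (f' a - f' b)
          + E phi
        /\ (`|E phi|%:E <= Lnorm_itv 1 a b f'' * ((b - a) ^+ 2 / 16)%:E)%E,
      2 <= p ->
        let phi := fun x => (x - c) ^+ 2 - (b - a) ^+ 2 / 12 in
        integral_itv a b f =
          (b - a) / 2 * (f a + f b) + (b - a) ^+ 2 / 12 * (f' a - f' b)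
          + E phi
        /\ (`|E phi|%:E <=
              Lnorm_itv 2 a b f''
              * ((b - a) `^ (5 / 2) / (12 * Num.sqrt 5))%:E)%E
    & forall q : R, 1 < p -> p^-1 + q^-1 = 1 ->
        let phi := fun x => (x - c) ^+ 2 in
        integral_itv a b f =
          (b - a) / 2 * (f a + f b) + (b - a) ^+ 2 / 8 * (f' a - f' b)
          + E phi
        /\ (`|E phi|%:E <=
              Lnorm_itv p a b f''
              * ((b - a) `^ (2 + q^-1)
                 / (2 `^ (3 + q^-1) * (q + 2^-1) `^ q^-1))%:E)%E].
Proof.
move=> c f' f'' E ab df acf' p1 /andP[/= + _].
rewrite inE/= => mf''.
have {}mf'' : measurable_fun `[a, b] f''.
  exact: (measurable_restrictT f'' (measurable_itv _)).2.
have formula m := @corrected_trapezoid R a b m f ab df acf' mf''.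
split => [_|p2|q p1' pq].
- split.
    by rewrite (formula ((b - a) ^+ 2 / 8)) -/c -/f'; congr (_ + _ + _); field.
  have -> : (b - a) ^+ 2 / 16 = (b - a) ^+ 2 / 8 / 2 by field.
  apply: quadrature_error_le_sup => //; first exact: measurable_sqrB.
    by rewrite divr_ge0// sqr_ge0.
  move=> x /andP[ax xb]; rewrite ler_norml.
  (* The product [(x - a) * (b - x)] ranges between 0 and [(b - a) ^+ 2 / 4], so [phi] stays between
     plus and minus [(b - a) ^+ 2 / 8]. *)
  have -> : (x - c) ^+ 2 = (b - a) ^+ 2 / 4 - (x - a) * (b - x).
    by rewrite /c; field.
  have : 0 <= (x - a) * (b - x) by rewrite mulr_ge0 ?subr_ge0.
  have : (x - a) * (b - x) <= (b - a) ^+ 2 / 4.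
    rewrite -subr_ge0 (_ : _ - _ = (x - c) ^+ 2) ?sqr_ge0//.
    by rewrite /c; field.
  move: ((x - a) * (b - x)) ((b - a) ^+ 2) => t L *.
  by apply/andP; split; lra.
- split.
    by rewrite (formula ((b - a) ^+ 2 / 12)) -/c -/f'; congr (_ + _ + _); field.
  rewrite -(Lnorm2_sqrB ab); apply: quadrature_error_le_hoelder => //.
    exact: measurable_sqrB.
  by field.
- have q0 : 0 < q.
    rewrite -invr_gt0; have : p^-1 < 1 by rewrite invf_lt1// (lt_trans ltr01).
    by move: pq; lra.
  have phiE : (fun x => (x - c) ^+ 2) = (fun x => (x - c) ^+ 2 - 0).
    by apply/funext => x; rewrite subr0.
  split.
    by rewrite (formula 0) -/c -/f' -phiE; congr (_ + _ + _); field.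
  rewrite -(Lnorm_sqrB ab q0); apply: quadrature_error_le_hoelder => //.
    by rewrite phiE; exact: measurable_sqrB.
  exact: lt_le_trans p1.
Qed.
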